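(* Let $a>0$ and $n>0$ be real numbers, and let $L$ be the arc length of the supercircle with scale parameter $a$ and shape parameter $n$. Then $$L=\frac{8a}{n}\sum_{m=0}^{\infty}\frac{1}{u_m}\binom{1/2}{m}\,{}_2F_1\!\left(1+\frac1n,\,u_m;\,u_m+1;\,-1\right),$$ where $$u_m=\begin{cases}1+\dfrac{2m(1-n)}{n}, & 0<n\le 1,\\[8pt] \dfrac{1+2m(n-1)}{n}, & n\ge 1.\end{cases}$$
   Context: For real $a>0$, $n>0$, the supercircle with scale parameter $a$ and shape parameter $n$ is the closed plane curve given in polar coordinates by $r(\theta)=a\left(|\cos\theta|^n+|\sin\theta|^n\right)^{-1/n}$, $\theta\in[0,2\pi]$. Its arc length $L$ is the total length of this closed curve. $\binom{1/2}{m}=\frac{(1/2)(1/2-1)\cdots(1/2-m+1)}{m!}$ is the generalized binomial coefficient (equal to $1$ for $m=0$). ${}_2F_1(v,u;w;\gamma)$ is the Gauss hypergeometric function (analytically continued to $\mathbb{C}\setminus[1,\infty)$), given for $w>u>0$ and real $\gamma<1$ by Euler's integral ${}_2F_1(v,u;w;\gamma)=\frac{\Gamma(w)}{\Gamma(u)\Gamma(w-u)}\int_0^1\xi^{u-1}(1-\xi)^{w-u-1}(1-\gamma\xi)^{-v}\,d\xi$. *)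

(* Defs.v *)
From HB Require Import structures.
From mathcomp Require Import all_boot all_order all_algebra.
From mathcomp Require Import all_classical all_reals all_analysis.

Set Implicit Arguments.
Unset Strict Implicit.
Unset Printing Implicit Defensive.

Import Order.TTheory GRing.Theory Num.Theory.
Import numFieldNormedType.Exports.

Local Open Scope classical_set_scope.
Local Open Scope ring_scope.

Section ArcLength.
Context {R : realType}.
Implicit Types (p q : R * R) (a b : R) (c : R -> R * R) (s : seq R).

(* The norm MathComp-Analysis puts on R * R is the max norm, so the Euclidean
   distance is written out. *)
Definition eucl_dist p q : R :=
  Num.sqrt ((p.1 - q.1) ^+ 2 + (p.2 - q.2) ^+ 2).

(* a :: s is the increasing list of nodes; cf. variation, which is the same
   expression for real-valued functions. *)
Definition polygon_length a b c s : R :=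
  let P := c \o nth b (a :: s) in
  \sum_(0 <= i < size s) eucl_dist (P i.+1) (P i).

(* Length of the parametrized curve c on [a, b]: supremum of the lengths of the
   inscribed polygons, a priori in [0, +oo]; cf. total_variation. *)
Definition arc_length a b c : \bar R :=
  ereal_sup [set (polygon_length a b c s)%:E | s in itv_partition a b].

End ArcLength.

Section Supercircle.
Context {R : realType}.
Implicit Types a n t : R.

Definition supercircle_radius a n t : R :=
  a * (`|cos t| `^ n + `|sin t| `^ n) `^ (- n^-1).

Definition supercircle a n t : R * R :=
  (supercircle_radius a n t * cos t, supercircle_radius a n t * sin t).

End Supercircle.

Section SpecialFunctions.
Context {R : realType}.
Local Notation mu := (@lebesgue_measure R).

Definition gen_binom (x : R) (m : nat) : R :=
  (\prod_(0 <= k < m) (x - k%:R)) / m`!%:R.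

(* Meaningful for 0 < z, where the integral converges. *)
Definition Gamma (z : R) : R :=
  \int[mu]_(t in `]0, +oo[) (t `^ (z - 1) * expR (- t)).

(* Gauss' 2F1(v, u; w; g) by Euler's integral. Meaningful for 0 < u < w and
   g < 1, where the integral converges; unlike the power series it covers
   g = -1 for all v. *)
Definition hyp2F1 (v u w g : R) : R :=
  Gamma w / (Gamma u * Gamma (w - u)) *
  \int[mu]_(x in `]0, 1[)
    (x `^ (u - 1) * (1 - x) `^ (w - u - 1) * (1 - g * x) `^ (- v)).

End SpecialFunctions.

(* The two cases agree at n = 1. *)
Definition u_coef {R : realType} (n : R) (m : nat) : R :=
  if n <= 1 then 1 + 2 * m%:R * (1 - n) / n
  else (1 + 2 * m%:R * (n - 1)) / n.

(* Main.v *)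
(* By the symmetries of the square the curve is eight copies of the octant
   0 <= theta <= pi/4.  With t = tan^n theta this octant is
   (a (1 + t)^(-1/n), a t^(1/n) (1 + t)^(-1/n)), 0 <= t <= 1, whose speed is
   (a/n) t^(s-1) (1 + t)^(-1-1/n) sqrt (1 + t^(2r)), with s = min(1, 1/n) and
   r = |1 - n|/n.  The unit tangent extends continuously to the closed octant
   although the speed may blow up at t = 0; this is what makes the supremum of
   the inscribed polygons equal to the integral of the speed.  Since
   u_m = s + 2 m r, expanding the square root in powers of t^(2r) and recognizing
   Euler's integral gives the series.  The expansion converges uniformly on
   [0, 1]: if P_N is the N-th partial sum of the binomial series of sqrt (1 + q),
   the derivative of P_N(q) / sqrt (1 + q) is the single term
   - N b_N q^(N-1) (1 + q)^(-3/2), so the error is O(|b_N|) = O(1/N). *)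

Require Import Defs.
From HB Require Import structures.
From mathcomp Require Import all_boot all_order all_algebra.
From mathcomp Require Import all_classical all_reals all_analysis.
From mathcomp Require Import measurable_realfun ring lra.

Set Implicit Arguments.
Unset Strict Implicit.
Unset Printing Implicit Defensive.

Import Order.TTheory GRing.Theory Num.Theory.
Import numFieldNormedType.Exports.

Local Open Scope classical_set_scope.
Local Open Scope ring_scope.

(** * Arc length functions *)

Section RectifiableCurves.
Context {R : realType}.
Implicit Types (p q : R * R) (c : R -> R * R) (S : R -> R).

Lemma eucl_distC p q : eucl_dist p q = eucl_dist q p.
Proof. by rewrite /eucl_dist -sqrrN opprB -[X in _ + X]sqrrN opprB. Qed.

Lemma eucl_dist_ge0 p q : 0 <= eucl_dist p q.
Proof. exact: sqrtr_ge0. Qed.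

(** Cauchy-Schwarz in the plane, from Lagrange's identity: the product of the squared norms exceeds
    the squared dot product by [(x * w - y * z) ^+ 2]. *)
Lemma dot_le_sqrt (x y z w : R) :
  x * z + y * w <= Num.sqrt (x ^+ 2 + y ^+ 2) * Num.sqrt (z ^+ 2 + w ^+ 2).
Proof.
have h0 : 0 <= x ^+ 2 + y ^+ 2 by rewrite addr_ge0 ?sqr_ge0.
rewrite -sqrtrM// (le_trans (ler_norm _))// -sqrtr_sqr ler_wsqrtr//.
by rewrite -subr_ge0 (_ : _ - _ = (x * w - y * z) ^+ 2) ?sqr_ge0//; ring.
Qed.

Lemma eucl_dist_triangle p q r :
  eucl_dist p r <= eucl_dist p q + eucl_dist q r.
Proof.
have := dot_le_sqrt (p.1 - q.1) (p.2 - q.2) (q.1 - r.1) (q.2 - r.2).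
rewrite -/(eucl_dist p q) -/(eucl_dist q r).
have := eucl_dist_ge0 p q; have := eucl_dist_ge0 q r.
have := sqr_sqrtr (addr_ge0 (sqr_ge0 (p.1 - q.1)) (sqr_ge0 (p.2 - q.2))).
have := sqr_sqrtr (addr_ge0 (sqr_ge0 (q.1 - r.1)) (sqr_ge0 (q.2 - r.2))).
rewrite -/(eucl_dist p q) -/(eucl_dist q r).
move: (eucl_dist p q) (eucl_dist q r) => d e He Hd e0 d0 H.
rewrite -(ler_pXn2r (n := 2)) ?nnegrE ?sqrtr_ge0 ?addr_ge0//.
rewrite sqr_sqrtr ?addr_ge0 ?sqr_ge0//.
nra.
Qed.

(* Characterizes S as arc length up to a constant, by conditions which, unlike
   the supremum over polygons, are easily transported and glued. *)
Definition arc_length_function c (A B : R) S :=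
  (forall s t, A <= s -> s <= t -> t <= B -> eucl_dist (c t) (c s) <= S t - S s)
  /\
  (forall e x, 0 < e -> A <= x <= B ->
    \forall y \near within `[A, B] (nbhs x),
      (1 - e) * `|S y - S x| <= eucl_dist (c y) (c x)).

Definition has_length c A B L :=
  exists2 S, arc_length_function c A B S & S B - S A = L.

(** [B] and [B'] are only default values of [nth], never reached, so they may differ. *)
Lemma polygon_length_rcons (A B B' x : R) c (s : seq R) :
  polygon_length A B c (rcons s x) =
  polygon_length A B' c s + eucl_dist (c x) (c (last A s)).
Proof.
rewrite /polygon_length size_rcons big_nat_recr//=; congr (_ + _).
  apply: eq_big_nat => i /andP[_ si]; rewrite !nth_rcons.
  rewrite si; case: i si => [|i] si /=; first by rewrite (set_nth_default B').
  by rewrite nth_rcons (ltnW si)// !(set_nth_default B' B)// ltnW.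
rewrite nth_rcons ltnn eqxx; congr (eucl_dist _ (c _)).
case/lastP: s => //= s y; rewrite size_rcons /= last_rcons !nth_rcons.
by rewrite size_rcons ltnSn ltnn eqxx.
Qed.

Lemma polygon_length_cons (A B x : R) c (s : seq R) :
  polygon_length A B c (x :: s) =
  eucl_dist (c x) (c A) + polygon_length x B c s.
Proof. by rewrite /polygon_length/= big_nat_recl. Qed.

(** The chord bounds telescope along the partition; the induction lets the left end point move. *)
Lemma polygon_length_le c A B S s : arc_length_function c A B S ->
  itv_partition A B s -> polygon_length A B c s <= S B - S A.
Proof.
move=> [cS _]; suff H A' : A <= A' -> itv_partition A' B s ->
    polygon_length A' B c s <= S B - S A' by exact: H.
elim: s A' => [|x s ih] A' AA' sAB.
  by rewrite (itv_partition_nil sAB) /polygon_length big_nil subrr.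
have xB := itv_partition_le (itv_partition_cons sAB).
have A'x : A' < x by case: sAB => /= /andP[].
have := ih x (le_trans AA' (ltW A'x)) (itv_partition_cons sAB).
have := cS A' x AA' (ltW A'x) xB.
rewrite polygon_length_cons; lra.
Qed.

(** A continuity argument along [[A, B]]: the points reachable by a polygon that is good up to the
    factor [1 - e] have a supremum; the local condition there shows that it is reached and that it
    cannot lie before [B]. *)
Lemma arc_length_function_approx c A B S e : A <= B ->
  arc_length_function c A B S -> 0 < e ->
  exists2 s, itv_partition A B s &
    (1 - e) * (S B - S A) <= polygon_length A B c s.
Proof.
move=> AB [cS cloc] e0.
have Smono s t : A <= s -> s <= t -> t <= B -> S s <= S t.
  by move=> As st tB; rewrite -subr_ge0 (le_trans (eucl_dist_ge0 _ _) (cS _ _ As st tB)).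
pose G := [set t | A <= t <= B /\ exists2 s, itv_partition A t s &
    (1 - e) * (S t - S A) <= polygon_length A t c s].
have step t y : G t -> t <= y -> y <= B ->
    (1 - e) * (S y - S t) <= eucl_dist (c y) (c t) -> G y.
  move=> [/andP[At tB] [s sAt Hs]]; rewrite le_eqVlt => /predU1P[<- _ _|ty yB H].
    by split; [rewrite At|exists s].
  split; first by rewrite yB andbT (le_trans At (ltW ty)).
  have [ps /eqP ls] := sAt.
  exists (rcons s y); first by split; rewrite ?last_rcons// rcons_path ps/= ls.
  rewrite (polygon_length_rcons _ _ t) ls; lra.
have GA : G A.
  split; first by rewrite lexx.
  by exists [::]; rewrite /polygon_length ?big_nil ?subrr ?mulr0//; split => /=.
have hG : has_sup G.
  by split; [exists A | exists B => t [/andP[]]].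
set x := sup G.
have Ax : A <= x by apply: ub_le_sup => //; case: hG.
have xB : x <= B by apply: ge_sup; [exists A | move=> t [/andP[]]].
have := cloc e x e0; rewrite Ax xB => /(_ isT).
rewrite near_withinE => /nbhs_ballP[/= d d0 Hd].
have [t Gt xdt] := sup_adherent d0 hG.
have tx : t <= x by apply: ub_le_sup => //; case: hG.
have [/andP[At tB] _] := Gt.
(* The supremum is reached: some [t] in [G] lies within [d] of [x], so the chord from [t] to [x] can
   be appended. *)
have Gx : G x.
  apply: (step t) => //; rewrite eucl_distC -(ger0_norm (x := S x - S t)).
    rewrite distrC; apply: Hd; last by rewrite /= in_itv/= At.
    by rewrite /ball/= ger0_norm ?subr_ge0//; rewrite -/x in xdt; lra.
  by rewrite subr_ge0 Smono.
suff xE : x = B by rewrite -xE; case: Gx.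
apply/eqP; rewrite eq_le xB leNgt; apply/negP => xltB.
(* A point beyond [x] but still in the ball of radius [d]; appending it to the polygon contradicts
   the choice of [x]. *)
pose y := Num.min B (x + d / 2).
have yB : y <= B by rewrite /y ge_min lexx.
have xy : x < y by rewrite /y lt_min xltB ltrDl divr_gt0.
have yd : y <= x + d / 2 by rewrite /y ge_min lexx orbT.
suff Gy : G y.
  have : y <= x by apply: ub_le_sup => //; case: hG.
  lra.
apply: (step x) => //; first exact: ltW.
rewrite -(ger0_norm (x := S y - S x)) ?subr_ge0 ?Smono ?(ltW xy)//.
apply: Hd; last by rewrite /= in_itv/= yB andbT; lra.
by rewrite /ball/= distrC ger0_norm ?subr_ge0 ?(ltW xy)//; lra.
Qed.

Lemma has_length_arc_length c A B L : A <= B -> has_length c A B L ->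
  arc_length A B c = L%:E.
Proof.
move=> AB [S cS <-]; apply/eqP; rewrite eq_le; apply/andP; split.
  by apply: ge_ereal_sup => _ [s sAB <-]; rewrite lee_fin; exact: polygon_length_le.
have SAB : 0 <= S B - S A.
  by apply: le_trans (eucl_dist_ge0 (c B) (c A)) _; case: cS => + _; apply.
apply/lee_addgt0Pr => e e0.
(* The relative error is chosen so that the absolute error is at most [e]; adding 1 keeps the
   denominator positive for a curve of length zero. *)
have e'0 : 0 < e / (S B - S A + 1) by rewrite divr_gt0// ltr_wpDl.
have [s sAB Hs] := arc_length_function_approx AB cS e'0.
apply: le_trans (leeD2r _ (ereal_sup_ubound _)); last by exists s.
rewrite -EFinD lee_fin -lerBlDr; apply: le_trans Hs.
rewrite mulrBl mul1r lerD2l lerN2 mulrAC ler_pdivrMr ?ltr_wpDl//.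
by rewrite ler_pM2l// lerDl.
Qed.

(** Both functions are shifted to vanish at [B] and then glued. A chord across [B] is bounded by the
    triangle inequality, and only at [x = B] are both local conditions needed. *)
Lemma has_length_cat c A B C L1 L2 : A <= B -> B <= C ->
  has_length c A B L1 -> has_length c B C L2 -> has_length c A C (L1 + L2).
Proof.
move=> AB BC [S1 [ch1 loc1] <-] [S2 [ch2 loc2] <-].
pose S t := if t <= B then S1 t - S1 B else S2 t - S2 B.
have SE1 t : t <= B -> S t = S1 t - S1 B by rewrite /S => ->.
have SE2 t : B <= t -> S t = S2 t - S2 B.
  rewrite le_eqVlt => /predU1P[<-|Bt]; first by rewrite SE1// !subrr.
  by rewrite /S leNgt Bt.
exists S; last by rewrite (SE1 A)// (SE2 C)//; ring.
split.
  move=> s t As st tC.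
  have [tB|Bt] := leP t B.
    rewrite !SE1 ?(le_trans st)//.
    by have := ch1 s t As st tB; lra.
  have [sB|Bs] := leP s B.
    rewrite (SE1 s)// (SE2 t) ?(ltW Bt)//.
    have := eucl_dist_triangle (c t) (c B) (c s).
    have := ch1 s B As sB (lexx _); have := ch2 B t (lexx _) (ltW Bt) tC; lra.
  rewrite !SE2 ?(ltW Bs) ?(ltW Bt)//.
  by have := ch2 s t (ltW Bs) st tC; lra.
move=> e x e0 /andP[Ax xC].
have near1 : x <= B -> \forall y \near nbhs x, A <= y <= B ->
    (1 - e) * `|S y - S x| <= eucl_dist (c y) (c x).
  move=> xB; have := loc1 e x e0; rewrite Ax xB => /(_ isT).
  rewrite near_withinE; apply: filterS => y + /[dup] /andP[_ yB].
  by rewrite /= in_itv/= !SE1// (_ : S1 y - S1 B - (S1 x - S1 B) = S1 y - S1 x)//; ring.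
have near2 : B <= x -> \forall y \near nbhs x, B <= y <= C ->
    (1 - e) * `|S y - S x| <= eucl_dist (c y) (c x).
  move=> Bx; have := loc2 e x e0; rewrite Bx xC => /(_ isT).
  rewrite near_withinE; apply: filterS => y + /[dup] /andP[By _].
  by rewrite /= in_itv/= !SE2// (_ : S2 y - S2 B - (S2 x - S2 B) = S2 y - S2 x)//; ring.
rewrite near_withinE; case: (ltgtP x B) => [xB|Bx|xB].
- apply: filterS2 (near1 (ltW xB)) (lt_nbhsl xB) => y Hy yB.
  by rewrite /= in_itv/= => /andP[Ay _]; apply: Hy; rewrite Ay ltW.
- apply: filterS2 (near2 (ltW Bx)) (lt_nbhsr Bx) => y Hy yB.
  by rewrite /= in_itv/= => /andP[_ yC]; apply: Hy; rewrite yC andbT ltW.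
- have := near2; have := near1; rewrite xB => /(_ (lexx _)) n1 /(_ (lexx _)) n2.
  apply: filterS2 n1 n2 => y Hy1 Hy2; rewrite /= in_itv/= => /andP[Ay yC].
  by have [yB|/ltW By] := leP y B; [apply: Hy1; rewrite Ay | apply: Hy2; rewrite By].
Qed.

(** The function for [c'] is [S \o phi]. Only chord lengths are compared, so the same lemma covers
    changes of parameter and isometries of the plane. *)
Lemma has_length_comp c c' A B A' B' L (phi : R -> R) :
  {within `[A, B], continuous phi} ->
  {in `[A, B] &, {homo phi : s t / s <= t}} -> A <= B ->
  phi A = A' -> phi B = B' ->
  {in `[A, B] &, forall s t,
    eucl_dist (c' s) (c' t) = eucl_dist (c (phi s)) (c (phi t))} ->
  has_length c A' B' L -> has_length c' A B L.
Proof.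
move=> /subspace_continuousP cphi mphi AB <- <- cc' [S [ch loc] <-].
have inA : A \in `[A, B] by rewrite in_itv/= lexx.
have inB : B \in `[A, B] by rewrite in_itv/= lexx andbT.
have phiAB t : t \in `[A, B] -> phi A <= phi t <= phi B.
  by move=> tAB; move: (tAB); rewrite in_itv/= => /andP[At tB]; rewrite !mphi.
exists (S \o phi); last by [].
split.
  move=> s t As st tB /=.
  have sI : s \in `[A, B] by rewrite in_itv/= As (le_trans st).
  have tI : t \in `[A, B] by rewrite in_itv/= tB (le_trans As).
  have /andP[h1 _] := phiAB s sI; have /andP[_ h2] := phiAB t tI.
  by rewrite cc'//; apply: ch => //; exact: mphi.
move=> e x e0 xAB.
have xI : x \in `[A, B] by rewrite in_itv.
have := loc e (phi x) e0 (phiAB x xI).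
rewrite near_withinE => /(cphi x xI) h.
have {h} : \forall y \near within `[A, B] (nbhs x), phi y \in `[phi A, phi B] ->
    (1 - e) * `|S (phi y) - S (phi x)| <= eucl_dist (c (phi y)) (c (phi x)) := h.
rewrite !near_withinE; apply: filterS => y Hy yI /=.
by rewrite cc'//; apply: Hy => //; rewrite in_itv/= phiAB.
Qed.

(** The orientation is reversed, and the sign in [- S (K - t)] makes the new function nondecreasing
    again. *)
Lemma has_length_rev c c' A B A' B' K L :
  A' = K - B -> B' = K - A ->
  {in `[A, B] &, forall s t,
    eucl_dist (c' s) (c' t) = eucl_dist (c (K - s)) (c (K - t))} ->
  has_length c A' B' L -> has_length c' A B L.
Proof.
move=> -> -> cc' [S [ch loc] <-].
exists (fun t => - S (K - t)); last by ring.
split.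
  move=> s t As st tB.
  have sI : s \in `[A, B] by rewrite in_itv/= As (le_trans st).
  have tI : t \in `[A, B] by rewrite in_itv/= tB (le_trans As).
  rewrite cc'// eucl_distC /= opprK [leRHS]addrC.
  by apply: ch; lra.
move=> e x e0 xAB.
have xI : x \in `[A, B] by rewrite in_itv.
have := loc e (K - x) e0; rewrite (_ : _ <= _ <= _); last by lra.
have cK : (fun t : R => K - t) @ x --> K - x.
  by apply: cvgB; [exact: cvg_cst|exact: cvg_id].
move=> /(_ isT); rewrite near_withinE => /cK h.
have {h} : \forall y \near x, K - y \in `[K - B, K - A] ->
    (1 - e) * `|S (K - y) - S (K - x)| <= eucl_dist (c (K - y)) (c (K - x)) := h.
rewrite near_withinE; apply: filterS => y Hy yI.
rewrite cc'// -opprD normrN -/(_ - _); apply: Hy.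
by move: yI; rewrite /= !in_itv/= => /andP[Ay yB]; apply/andP; split; lra.
Qed.

End RectifiableCurves.

(** * Continuity relative to a set *)

Section WithinContinuous.
Context {R : realType}.
Implicit Types (D : set R) (f g : R -> R).

Lemma within_continuous_cvg D f (x : R) : {within D, continuous f} -> D x ->
  f @ within D (nbhs x) --> f x.
Proof. by move/subspace_continuousP => /[apply]. Qed.

Lemma within_continuous_cst D (k : R) : {within D, continuous (fun _ : R => k)}.
Proof. by apply: continuous_subspaceT => x; exact: cst_continuous. Qed.

Lemma within_continuous_add D f g : {within D, continuous f} ->
  {within D, continuous g} -> {within D, continuous (fun x => f x + g x)}.
Proof. exact: within_continuousD. Qed.

Lemma within_continuous_mul D f g : {within D, continuous f} ->
  {within D, continuous g} -> {within D, continuous (fun x => f x * g x)}.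
Proof.
move=> /subspace_continuousP cf /subspace_continuousP cg.
by apply/subspace_continuousP => x Dx; apply: cvgM; [exact: cf|exact: cg].
Qed.

End WithinContinuous.

(** * Curves with an integrable speed and a continuous unit tangent *)

Section UnitTangent.
Context {R : realType}.
Notation mu := (@lebesgue_measure R).
Variables (X Y sg al be : R -> R) (A B : R).
Hypothesis AB : A < B.
Hypothesis isg : mu.-integrable `[A, B] (EFin \o sg).
Hypothesis csg : {in `]A, B[, continuous sg}.
Hypothesis sg0 : {in `]A, B[, forall t, 0 <= sg t}.
Hypothesis unit_tangent : {in `[A, B], forall t, al t ^+ 2 + be t ^+ 2 = 1}.
Hypothesis cX : {within `[A, B], continuous X}.
Hypothesis cY : {within `[A, B], continuous Y}.
Hypothesis cal : {within `[A, B], continuous al}.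
Hypothesis cbe : {within `[A, B], continuous be}.
Hypothesis dX : {in `]A, B[, forall t : R, is_derive t 1 X (sg t * al t)}.
Hypothesis dY : {in `]A, B[, forall t : R, is_derive t 1 Y (sg t * be t)}.

Let S x := parameterized_integral mu A x sg.

Let is_derive_S : {in `]A, B[, forall t : R, is_derive t 1 S (sg t)}.
Proof.
move=> t tAB; move: (tAB); rewrite in_itv/= => /andP[At tB].
have [] := continuous_FTC1_closed tB isg At (csg tAB).
by move=> h1 h2; apply: DeriveDef; rewrite -?derive1E.
Qed.

(* Chords are compared with S through the linear functionals p X + q Y. *)
Let combination_le k p q s t : A <= s -> s <= t -> t <= B ->
  {in `]s, t[, forall z, 0 <= k + p * al z + q * be z} ->
  k * S s + p * X s + q * Y s <= k * S t + p * X t + q * Y t.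
Proof.
move=> As st tB H.
pose F z := k * S z + p * X z + q * Y z.
have dF z : z \in `]s, t[ ->
    is_derive z 1 F (sg z * (k + p * al z + q * be z)).
  rewrite in_itv/= => /andP[sz zt].
  have zAB : z \in `]A, B[ by rewrite in_itv/= (le_lt_trans As)// (lt_le_trans zt).
  have dSz := is_derive_S zAB; have dXz := dX zAB; have dYz := dY zAB.
  apply: is_derive_eq; rewrite /GRing.scale/=; ring.
apply: (@ger0_derive1_ndecr R F s t) => //.
- by move=> z zst; apply: ex_derive; exact: dF.
- move=> z zst; rewrite derive1E (@derive_val _ _ _ _ _ _ _ (dF z zst)).
  rewrite mulr_ge0 ?H// sg0//.
  move: zst; rewrite !in_itv/= => /andP[sz zt].
  by rewrite (le_lt_trans As)// (lt_le_trans zt).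
- apply: (@continuous_subspaceW _ _ _ `[A, B]).
    by apply: subset_itv; rewrite bnd_simp.
  have cS : {within `[A, B], continuous S}.
    exact: parameterized_integral_continuous (ltW AB) isg.
  apply: within_continuous_add; first apply: within_continuous_add.
  all: by apply: within_continuous_mul => //; exact: within_continuous_cst.
Qed.

(** The primitive [S] of the speed [sg] is the arc length function. The local condition rests on the
    tangent [(al, be)], continuous up to the end points, and not on [sg], which may be unbounded
    there. *)
Lemma has_length_unit_tangent :
  has_length (fun t => (X t, Y t)) A B (\int[mu]_(t in `[A, B]) sg t).
Proof.
exists S; last first.
  by rewrite /S /parameterized_integral set_itv1 Rintegral_set1 subr0.
split.
  move=> s t As st tB.
  set d := eucl_dist _ _.
  have d0 : 0 <= d by exact: eucl_dist_ge0.
  have S_le : S s <= S t.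
    have := @combination_le 1 0 0 s t As st tB.
    rewrite !mul0r !addr0 !mul1r; apply.
    by move=> z _; rewrite !mul0r !addr0.
  (* The functional is minus the dot product with the chord itself, and [k] is its length [d].
     Cauchy-Schwarz against the unit tangent gives the sign, and comparing the ends gives
     [d * d <= d * (S t - S s)]. *)
  have H0 : {in `]s, t[, forall z,
      0 <= d + - (X t - X s) * al z + - (Y t - Y s) * be z}.
    move=> z; rewrite in_itv/= => /andP[sz zt].
    have := dot_le_sqrt (X t - X s) (Y t - Y s) (al z) (be z).
    rewrite unit_tangent ?sqrtr1 ?mulr1 -/d; first by rewrite /d /eucl_dist/=; lra.
    by rewrite in_itv/= (le_trans As (ltW sz))// (le_trans (ltW zt)).
  have H := combination_le As st tB H0.
  have d2 : d ^+ 2 = (X t - X s) ^+ 2 + (Y t - Y s) ^+ 2.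
    by rewrite /d /eucl_dist sqr_sqrtr//= addr_ge0 ?sqr_ge0.
  have : d * d <= d * (S t - S s) by nra.
  move: d0; rewrite le_eqVlt => /predU1P[<- _|d0]; first by rewrite subr_ge0.
  by rewrite ler_pM2l.
move=> e x e0 xAB.
have xI : x \in `[A, B] by rewrite in_itv.
have near_dot : \forall y \near within `[A, B] (nbhs x),
    1 - e < al x * al y + be x * be y.
  have cdot : {within `[A, B], continuous (fun y => al x * al y + be x * be y)}.
    by apply: within_continuous_add; apply: within_continuous_mul => //;
      exact: within_continuous_cst.
  have lt1 : 1 - e < al x * al x + be x * be x.
    by rewrite -!expr2 unit_tangent// ltrBlDr ltrDl.
  exact: cvgr_gt _ (within_continuous_cvg cdot xI) _ lt1.
rewrite near_withinE in near_dot.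
have /nbhs_ballP[/= d d0 Hd] := near_dot.
have local s t : A <= s -> s <= t -> t <= B -> x - d < s -> t < x + d ->
    (1 - e) * (S t - S s) <= eucl_dist (X t, Y t) (X s, Y s).
  move=> As st tB xs tx.
  (* The functional is now the projection on the tangent at [x]; near [x] the projected speed is at
     least [(1 - e)] times the speed, and a chord is at least as long as its projection. *)
  have H0 : {in `]s, t[, forall z,
      0 <= - (1 - e) + al x * al z + be x * be z}.
    move=> z; rewrite in_itv/= => /andP[sz zt].
    have := Hd z; rewrite /ball/= in_itv/=.
    have -> : `|x - z| < d by rewrite ltr_norml; lra.
    rewrite (le_trans As (ltW sz)) (le_trans (ltW zt) tB) => /(_ isT isT); lra.
  have H := combination_le As st tB H0.
  have := dot_le_sqrt (X t - X s) (Y t - Y s) (al x) (be x).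
  rewrite unit_tangent// sqrtr1 mulr1 /eucl_dist/=; lra.
have S_le s t : A <= s -> s <= t -> t <= B -> S s <= S t.
  move=> As st tB; have := @combination_le 1 0 0 s t As st tB.
  rewrite !mul0r !addr0 !mul1r; apply.
  by move=> z _; rewrite !mul0r !addr0.
rewrite near_withinE; apply/nbhs_ballP; exists d => // y.
rewrite /ball/= ltr_norml in_itv/= => /andP[yx1 yx2] /andP[Ay yB].
have /andP[Ax xB] := xAB.
have [xy|/ltW yx] := leP x y.
  rewrite ger0_norm ?subr_ge0 ?S_le//; apply: local => //; lra.
rewrite distrC eucl_distC ger0_norm ?subr_ge0 ?S_le//; apply: local => //; lra.
Qed.

End UnitTangent.

(** * The Gamma function *)

Section PowerFunctions.
Context {R : realType}.
Implicit Types (x p : R).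

Lemma powRD_gt0 x p q : 0 < x -> x `^ (p + q) = x `^ p * x `^ q.
Proof. by move=> x0; rewrite powRD// (gt_eqF x0) implybT. Qed.

Lemma mul_powRB1 x p : 0 < x -> x * x `^ (p - 1) = x `^ p.
Proof.
by move=> x0; rewrite -{1}(powRr1 (ltW x0)) -powRD_gt0// addrC subrK.
Qed.

Lemma continuous_powR x p : 0 < x -> {for x, continuous (@powR R ^~ p)}.
Proof.
move=> x0; apply: differentiable_continuous; apply/derivable1_diffP.
by apply: derivable_powR; rewrite in_itv/= x0.
Qed.

Lemma is_derive_powR1D x p : 0 < 1 + x ->
  is_derive x 1 (fun t : R => (1 + t) `^ p) (p * (1 + x) `^ (p - 1)).
Proof.
move=> x0.
have h : is_derive (1 + x) 1 (@powR R ^~ p) (p * (1 + x) `^ (p - 1)).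
  exact: is_derive1_powR.
have g : is_derive x 1 (fun t : R => 1 + t) (1 : R).
  by have := is_deriveD (is_derive_cst (1 : R) x 1) (is_derive_id x 1); rewrite add0r.
have := @is_derive1_comp R (@powR R ^~ p) (fun t : R => 1 + t) x _ _ h g.
by rewrite mulr1.
Qed.

Lemma continuous_powR1D x p : 0 < 1 + x ->
  {for x, continuous (fun t : R => (1 + t) `^ p)}.
Proof.
move=> x0; apply: differentiable_continuous; apply/derivable1_diffP.
exact: (@ex_derive _ _ _ _ _ _ _ (is_derive_powR1D p x0)).
Qed.

Lemma measurable_powR1D (D : set R) p :
  measurable_fun D (fun t : R => (1 + t) `^ p).
Proof.
apply: (measurableT_comp (measurable_powR p)).
by apply: measurable_funD => //; exact: measurable_cst.
Qed.

End PowerFunctions.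

(** * Improper integrals over the positive half-line *)

Section ImproperIntegral.
Context {R : realType}.
Notation mu := (@lebesgue_measure R).

(** As [f] may be singular at 0, the fundamental theorem is applied on the half-lines from
    [k.+1%:R^-1], and monotone convergence gives the limit. *)
Lemma ge0_integral_0y (f F : R -> R) (l0 l : R) :
  (forall x, 0 < x -> 0 <= f x) -> (forall x, 0 < x -> {for x, continuous f}) ->
  (forall x : R, 0 < x -> is_derive x 1 F (f x)) ->
  F x @[x --> 0^'+] --> l0 -> F x @[x --> +oo] --> l ->
  (\int[mu]_(x in `]0%R, +oo[) (f x)%:E = (l - l0)%:E)%E.
Proof.
move=> f0 cf dF Fl0 Fl.
pose E k := `[(k.+1%:R^-1 : R), +oo[%classic.
have EE : \bigcup_k E k = `]0, +oo[%classic.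
  apply/seteqP; split=> [x [k _]|x]; rewrite /E/= !in_itv/= !andbT.
    by move=> kx; rewrite (lt_le_trans _ kx)// invr_gt0.
  move=> x0; exists (Num.truncn x^-1) => //; rewrite /E/= in_itv/= andbT ltW//.
  by rewrite invf_plt ?posrE// truncnS_gt.
have iE k : (\int[mu]_(x in E k) (f x)%:E = l%:E - (F k.+1%:R^-1)%:E)%E.
  have k0 : 0 < k.+1%:R^-1 :> R by rewrite invr_gt0.
  apply: ge0_continuous_FTC2y => //.
  - by move=> x kx; rewrite f0// (lt_le_trans k0).
  - apply/continuous_within_itvcyP; split.
      by move=> x; rewrite in_itv/= andbT => kx; apply: cf; exact: lt_trans kx.
    by apply: cvg_at_right_filter; exact: cf.
  - by move=> x kx; apply: ex_derive; apply: dF; exact: lt_trans kx.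
  - apply: cvg_at_right_filter; apply: differentiable_continuous.
    by apply/derivable1_diffP; apply: ex_derive; exact: dF.
  - move=> x; rewrite in_itv/= andbT => kx.
    by rewrite derive1E (@derive_val _ _ _ _ _ _ _ (dF x (lt_trans k0 kx))).
have mf : measurable_fun (`]0, +oo[%classic : set R) f.
  apply: open_continuous_measurable_fun => //.
  by move=> x; rewrite inE/= in_itv/= andbT; exact: cf.
have : (\int[mu]_(x in E k) (f x)%:E @[k --> \oo] -->
    \int[mu]_(x in \bigcup_k E k) (f x)%:E)%E.
  apply: ge0_nondecreasing_set_cvg_integral.
  - move=> i j ij; rewrite subsetEset => x; rewrite /E/= !in_itv/= !andbT.
    by apply: le_trans; rewrite lef_pV2 ?posrE// ler_nat.
  - by move=> i; exact: measurable_itv.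
  - move=> i; apply/measurable_EFinP.
    apply: measurable_funS mf => //.
    by rewrite -EE; exact: bigcup_sup.
  - move=> i x; rewrite /E/= in_itv/= andbT => ix; rewrite lee_fin f0//.
    by rewrite (lt_le_trans _ ix)// invr_gt0.
rewrite EE => h.
suff h' : (\int[mu]_(x in E k) (f x)%:E @[k --> \oo] --> (l - l0)%:E)%E.
  exact: (cvg_unique _ h h').
rewrite (eq_cvg _ _ iE); under eq_fun do rewrite -EFinB.
apply: cvg_EFin; first exact: nearW.
apply: cvgB; first exact: cvg_cst.
move/cvg_at_rightP : Fl0; apply; split=> [k|]; first by rewrite invr_gt0.
exact: cvg_harmonic.
Qed.

End ImproperIntegral.

(** * Convergence, functional equation and positivity of Gamma *)

Section GammaFunction.
Context {R : realType}.
Notation mu := (@lebesgue_measure R).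
Implicit Types (u p t : R).

(** From [1 + t <= p * (1 + t / p) <= p * expR (t / p)], raised to the power [p]. *)
Lemma expRN_le_powR1D p t : 1 <= p -> 0 < t ->
  expR (- t) <= p `^ p * (1 + t) `^ (- p).
Proof.
move=> p1 t0; have p0 : 0 < p by rewrite (lt_le_trans _ p1).
have t10 : 0 < 1 + t by rewrite addr_gt0.
rewrite powRN expRN ler_pdivlMr ?powR_gt0// mulrC ler_pdivrMr ?expR_gt0//.
have -> : expR t = expR (t / p) `^ p by rewrite -expRM divfK// gt_eqF.
rewrite -powRM ?expR_ge0 ?(ltW p0)//.
apply: ge0_ler_powR; rewrite ?nnegrE ?(ltW p0) ?(ltW t10)//.
  by rewrite mulr_ge0 ?expR_ge0// ltW.
apply: (@le_trans _ _ (p * (1 + t / p))).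
  by rewrite mulrDr mulr1 mulrCA divff ?gt_eqF// mulr1 lerD2r.
by rewrite ler_pM2l// expR_ge1Dx.
Qed.

(* Phi u t = (t / (1 + t))^u increases from 0 to 1, and its derivative dominates
   the integrand of Gamma u up to a constant. *)
Let Phi u t := t `^ u * (1 + t) `^ (- u).

(** The integrand of the Beta integral B(u, 1) on the half-line, of total mass [u^-1]. *)
Let beta_dens u t := t `^ (u - 1) * (1 + t) `^ (- (u + 1)).

Let is_derive_Phi u t : 0 < t -> is_derive t 1 (Phi u) (u * beta_dens u t).
Proof.
move=> t0; have t10 : 0 < 1 + t by rewrite addr_gt0.
have d1 : is_derive t 1 (@powR R ^~ u) (u * t `^ (u - 1)) by exact: is_derive1_powR.
have d2 := is_derive_powR1D (- u) t10.
have := is_deriveM d1 d2; rewrite /GRing.scale/=.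
rewrite -(mul_powRB1 u t0) -(mul_powRB1 (- u) t10).
move=> h; apply: (is_derive_eq h).
by rewrite /beta_dens opprD; ring.
Qed.

Let cvg_inv1D : (1 + t)^-1 @[t --> +oo] --> (0 : R).
Proof.
apply/gtr0_cvgV0; last first.
  by under eq_cvg do rewrite addrC; exact: cvg_addrr.
near=> t; rewrite addr_gt0//.
Unshelve. all: by end_near. Qed.

Let Phi_cvg0 u : 0 < u -> Phi u t @[t --> 0^'+] --> 0.
Proof.
move=> u0; rewrite -[X in _ --> X](mul0r ((1 + 0) `^ (- u))).
apply: cvgM; first exact: powR_cvg0.
apply: cvg_at_right_filter; apply: continuous_powR1D; lra.
Qed.

Let Phi_cvgy u : Phi u t @[t --> +oo] --> (1 : R).
Proof.
(* For positive [t] this power is [Phi u t], because [t / (1 + t) = 1 - (1 + t)^-1]. *)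
have h : (1 - (1 + t)^-1) `^ u @[t --> +oo] --> (1 : R).
  have h : 1 - (1 + t)^-1 @[t --> +oo] --> (1 : R).
    by rewrite -[X in _ --> X]subr0; apply: cvgB; [exact: cvg_cst|exact: cvg_inv1D].
  have := continuous_cvg _ (@continuous_powR R 1 u ltr01) h.
  by rewrite /= powR1; apply.
apply: cvg_trans h; apply: near_eq_cvg; near=> t.
have t0 : 0 < t by near: t; exact: nbhs_pinfty_gt.
have t10 : 0 < 1 + t by rewrite addr_gt0.
rewrite /Phi -[- u]mulN1r powRrM powR_inv1 ?(ltW t10)//.
rewrite -powRM ?invr_ge0 ?ltW//; congr (_ `^ _).
by field; rewrite gt_eqF.
Unshelve. all: by end_near. Qed.

Let beta_dens_ge0 u t : 0 <= beta_dens u t.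
Proof. by rewrite mulr_ge0 ?powR_ge0. Qed.

Let beta_dens_continuous u t : 0 < t -> {for t, continuous (beta_dens u)}.
Proof.
move=> t0; apply: cvgM; first exact: continuous_powR.
by apply: continuous_powR1D; rewrite addr_gt0.
Qed.

Let integral_beta_dens u : 0 < u ->
  (\int[mu]_(t in `]0%R, +oo[) (u * beta_dens u t)%:E = 1)%E.
Proof.
move=> u0; rewrite -[RHS](_ : (1 - 0)%:E = _); last by rewrite subr0.
apply: (@ge0_integral_0y R _ (Phi u)).
- by move=> t t0; rewrite mulr_ge0 ?beta_dens_ge0 ?(ltW u0).
- by move=> t t0; apply: cvgM; [exact: cvg_cst | exact: beta_dens_continuous].
- by move=> t t0; exact: is_derive_Phi.
- exact: Phi_cvg0.
- exact: Phi_cvgy.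
Qed.

Let integrable_beta_dens u : 0 < u ->
  mu.-integrable `]0%R, +oo[ (EFin \o (fun t => u * beta_dens u t)).
Proof.
move=> u0; apply/integrableP; split.
  apply/measurable_EFinP; apply: measurable_funM; first exact: measurable_cst.
  apply: measurable_funM; last exact: measurable_powR1D.
  by apply: measurable_funTS; exact: measurable_powR.
rewrite (_ : integral _ _ _ = 1%E) ?ltry// -(integral_beta_dens u0).
by apply: eq_integral => t _; rewrite /= ger0_norm// mulr_ge0 ?beta_dens_ge0 ?(ltW u0).
Qed.

Let gamma_dens u t := t `^ (u - 1) * expR (- t).

Let gamma_dens_le u t : 0 < u -> 0 < t ->
  gamma_dens u t <= (u + 1) `^ (u + 1) * beta_dens u t.
Proof.
move=> u0 t0; rewrite mulrCA ler_wpM2l ?powR_ge0// expRN_le_powR1D//.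
by rewrite lerDr ltW.
Qed.

Let measurable_gamma_dens (D : set R) u : measurable_fun D (gamma_dens u).
Proof.
apply: measurable_funM; first by apply: measurable_funTS; exact: measurable_powR.
by apply: measurableT_comp => //; exact: measurable_funN.
Qed.

Lemma integrable_Gamma u : 0 < u ->
  mu.-integrable `]0%R, +oo[ (EFin \o (fun t => t `^ (u - 1) * expR (- t))).
Proof.
(* The constant of [gamma_dens_le], divided by the factor [u] that the integrable density
   carries. *)
move=> u0; pose C := (u + 1) `^ (u + 1) / u.
have C0 : 0 <= C by rewrite divr_ge0 ?powR_ge0 ?ltW.
have := @integrableZl _ _ R mu _ (measurable_itv _) C _ (integrable_beta_dens u0).
apply: le_integrable => //.
  by apply/measurable_EFinP; exact: measurable_gamma_dens.
move=> t; rewrite /= in_itv/= andbT => t0.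
rewrite lee_fin !ger0_norm ?mulr_ge0 ?invr_ge0 ?powR_ge0 ?expR_ge0 ?(ltW u0)//.
by rewrite mulrA divfK ?gt_eqF//; exact: gamma_dens_le.
Qed.

Lemma GammaD1 u : 0 < u -> Gamma (u + 1) = u * Gamma u.
Proof.
(* The derivative of - t^u e^(-t) has no constant sign; adding C * Phi u makes it
   nonnegative. *)
move=> u0; pose C := (u + 1) `^ (u + 1).
pose f t := C * (u * beta_dens u t) + (gamma_dens (u + 1) t - u * gamma_dens u t).
pose F t := C * Phi u t - t `^ u * expR (- t).
have u10 : 0 < u + 1 by rewrite addr_gt0.
have gammaS t : gamma_dens (u + 1) t = t `^ u * expR (- t).
  by rewrite /gamma_dens addrK.
have If : (\int[mu]_(t in `]0%R, +oo[) (f t)%:E = (C - 0)%:E)%E.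
  apply: (@ge0_integral_0y R _ F).
  - move=> t t0; rewrite /f.
    have := gamma_dens_le u0 t0; rewrite -/C -(ler_pM2l u0).
    have : 0 <= gamma_dens (u + 1) t by rewrite mulr_ge0 ?powR_ge0 ?expR_ge0.
    lra.
  - have cg v t : 0 < t -> {for t, continuous (gamma_dens v)}.
      move=> t0; apply: cvgM; first exact: continuous_powR.
      apply: continuous_comp; last exact: continuous_expR.
      exact: continuousN.
    move=> t t0; apply: cvgD.
      by do 2 (apply: cvgM; first exact: cvg_cst); exact: beta_dens_continuous.
    by apply: cvgB; [exact: cg|apply: cvgM; [exact: cvg_cst|exact: cg]].
  - move=> t t0.
    have d0 := is_derive_Phi u t0.
    have d1 : is_derive t 1 (@powR R ^~ u) (u * t `^ (u - 1)) by exact: is_derive1_powR.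
    have d2 : is_derive t 1 (fun t : R => expR (- t)) (- expR (- t)).
      have := @is_derive1_comp R expR (fun t : R => - t) t _ _
        (is_derive_expR _) (is_deriveN (is_derive_id t 1)).
      by rewrite mulrN1.
    have := is_deriveB (is_deriveZ C d0) (is_deriveM d1 d2).
    move=> h; apply: (is_derive_eq h).
    by rewrite /f gammaS /gamma_dens /GRing.scale/=; ring.
  - rewrite -[X in _ --> X](_ : C * 0 - 0 * expR (- 0) = 0); last first.
      by rewrite mulr0 mul0r subrr.
    apply: cvgB.
      by apply: cvgM; [exact: cvg_cst|exact: Phi_cvg0].
    apply: cvgM; first exact: powR_cvg0.
    apply: cvg_at_right_filter; apply: continuous_comp; last exact: continuous_expR.
    exact: continuousN.
  - rewrite -[X in _ --> X](_ : C * 1 - 0 = C); last by rewrite mulr1 subr0.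
    apply: cvgB.
      by apply: cvgM; [exact: cvg_cst|exact: Phi_cvgy].
    (* The majorant comes from [expRN_le_powR1D] with [p = u + 1], together with [t <= 1 + t] in the
       power [u]. *)
    apply: (@squeeze_cvgr _ _ _ _ (fun _ => 0) (fun t => C * (1 + t)^-1)).
    + near=> t.
      have t0 : 0 < t by near: t; exact: nbhs_pinfty_gt.
      have t10 : 0 < 1 + t by rewrite addr_gt0.
      rewrite mulr_ge0 ?powR_ge0 ?expR_ge0//=.
      apply: (@le_trans _ _ ((1 + t) `^ u * (C * (1 + t) `^ (- (u + 1))))).
        apply: ler_pM; rewrite ?powR_ge0 ?expR_ge0//.
          by apply: ge0_ler_powR; rewrite ?nnegrE ?ltW// ltrDr.
        by apply: expRN_le_powR1D => //; rewrite lerDr ltW.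
      rewrite mulrCA -powRD_gt0// (_ : u - (u + 1) = -1); last by ring.
      by rewrite powR_inv1 ?(ltW t10).
    + exact: cvg_cst.
    + rewrite -[X in _ --> X](mulr0 C).
      by apply: cvgM; [exact: cvg_cst|exact: cvg_inv1D].
have iu := integrable_Gamma u0; have iu1 := integrable_Gamma u10.
have ib := integrable_beta_dens u0.
have iub := @integrableZl _ _ R mu _ (measurable_itv _) u _ iu.
have iCb := @integrableZl _ _ R mu _ (measurable_itv _) C _ ib.
(* By linearity the left side is [C * 1 + (Gamma (u + 1) - u * Gamma u)], so the auxiliary [C]
   cancels. *)
have : \int[mu]_(t in `]0, +oo[) f t = C by rewrite /Rintegral If subr0.
rewrite RintegralD//; last first.
  by have := @integrableB _ _ R mu _ (measurable_itv _) _ _ iu1 iub.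
rewrite RintegralB// (RintegralZl C _ ib)// (RintegralZl u _ iu)//.
rewrite [X in C * X](_ : _ = 1); last by rewrite /Rintegral integral_beta_dens.
rewrite mulr1 => /eqP; rewrite -subr_eq0 addrAC subrr add0r subr_eq0 => /eqP.
by rewrite /Gamma /gamma_dens.
Unshelve. all: by end_near. Qed.

Lemma Gamma1 : Gamma (1 : R) = 1.
Proof.
rewrite /Gamma /Rintegral.
under eq_integral do rewrite subrr powRr0 mul1r.
suff -> : (\int[mu]_(t in `]0%R, +oo[) (expR (- t))%:E = (0 - -1)%:E)%E.
  by rewrite sub0r opprK.
apply: (@ge0_integral_0y R _ (fun t => - expR (- t))).
- by move=> t _; exact: expR_ge0.
- move=> t _; apply: continuous_comp; last exact: continuous_expR.
  exact: continuousN.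
- move=> t _.
  have := is_deriveN (@is_derive1_comp R expR (fun t : R => - t) t _ _
    (is_derive_expR _) (is_deriveN (is_derive_id t 1))).
  by rewrite mulrN1 opprK.
- apply: cvg_at_right_filter; rewrite -[X in _ --> - X]expR0 -[X in expR X]oppr0.
  apply: cvgN; apply: continuous_comp; last exact: continuous_expR.
  exact: continuousN.
- by rewrite -oppr0; apply: cvgN; exact: cvgr_expR.
Qed.

(** On [[1, 2]] the integrand is at least [2^-1 * expR (-2)], since [u - 1 > -1] gives a power no
    smaller than [t^-1]. *)
Lemma Gamma_gt0 u : 0 < u -> 0 < Gamma u.
Proof.
move=> u0; have iu := integrable_Gamma u0.
have sub : `[1, 2] `<=` (`]0, +oo[%classic : set R).
  by move=> t; rewrite /= !in_itv/= andbT => /andP[t1 _]; rewrite (lt_le_trans _ t1).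
apply: (@lt_le_trans _ _ (\int[mu]_(t in `[1, 2]) (2^-1 * expR (-2)))).
  have mu12 : mu `[1, 2] = 1%:E.
    by rewrite lebesgue_measure_itv/= lte_fin ltr1n/= -EFinB; congr EFin; ring.
  by rewrite Rintegral_cst// [X in fine X]mu12/= mulr1 mulr_gt0 ?expR_gt0.
apply: (@le_trans _ _ (\int[mu]_(t in `[1, 2]) (t `^ (u - 1) * expR (- t)))).
  apply: le_Rintegral => //.
  - apply: continuous_compact_integrable; first exact: segment_compact.
    by apply: continuous_subspaceT => x; exact: cst_continuous.
  - by apply: integrableS iu.
  - move=> t; rewrite /= in_itv/= => /andP[t1 t2].
    have t0 : 0 < t by rewrite (lt_le_trans _ t1).
    apply: ler_pM; rewrite ?invr_ge0 ?expR_ge0 ?ler_expR ?lerN2//.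
    apply: (@le_trans _ _ t^-1); first by rewrite lef_pV2 ?posrE.
    by rewrite -powR_inv1 ?(ltW t0)// ler_powR// lerBrDl; lra.
rewrite /Gamma /Rintegral fine_le//.
- by apply: integrable_fin_num => //; exact: integrableS iu.
- exact: integrable_fin_num.
- apply: ge0_subset_integral => //.
    by apply/measurable_EFinP; exact: measurable_gamma_dens.
  by move=> t _; rewrite lee_fin mulr_ge0 ?powR_ge0 ?expR_ge0.
Qed.

(** Below 1 the factor [expR (- t)] is at least [expR (- 1)], so integrability is inherited from
    Gamma. *)
Lemma integrable_powRB1 u : 0 < u ->
  mu.-integrable `]0%R, 1%R[ (EFin \o (fun t => t `^ (u - 1))).
Proof.
move=> u0.
have i01 : mu.-integrable `]0%R, 1%R[ (EFin \o (fun t => t `^ (u - 1) * expR (- t))).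
  by apply: integrableS (integrable_Gamma u0) => //; exact: subset_itvl.
have := @integrableZl _ _ R mu _ (measurable_itv _) (expR 1) _ i01.
apply: le_integrable => //.
  by apply/measurable_EFinP; apply: measurable_funTS; exact: measurable_powR.
move=> t; rewrite /= in_itv/= => /andP[t0 t1].
rewrite lee_fin !ger0_norm ?mulr_ge0 ?powR_ge0 ?expR_ge0//.
rewrite mulrCA -expRD ler_peMr ?powR_ge0// -[leLHS]expR0 ler_expR; lra.
Qed.

End GammaFunction.

(** * The binomial series of the square root *)

Section BinomialSeries.
Context {R : realType}.
Implicit Types (m N : nat) (q : R).

Local Notation b := (@gen_binom R (1 / 2)).

Lemma gen_binomS (x : R) m :
  m.+1%:R * gen_binom x m.+1 = (x - m%:R) * gen_binom x m.
Proof.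
rewrite /gen_binom big_nat_recr//= factS natrM.
have fm0 : m`!%:R != 0 :> R by rewrite pnatr_eq0 -lt0n fact_gt0.
have m0 : m.+1%:R != 0 :> R by rewrite pnatr_eq0.
by move: (m.+1%:R) m`!%:R fm0 m0 => c d d0 c0; field; rewrite ?c0 ?d0.
Qed.

(** The ratio of consecutive coefficients has modulus |1/2 - m| / (m + 1), which is at most (m + 1)
    / (m + 2). The case [m = 0] is separate because [1 / 2 - m] changes sign after it. *)
Lemma gen_binom_half_le m : `|b m| <= m.+1%:R^-1.
Proof.
elim: m => [|m ih]; first by rewrite /gen_binom big_geq// fact0 divr1 normr1 invr1.
have -> : b m.+1 = (1 / 2 - m%:R) / m.+1%:R * b m.
  by rewrite mulrAC -gen_binomS [RHS]mulrC mulKf.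
rewrite normrM; apply: le_trans (ler_wpM2l (normr_ge0 _) ih) _.
rewrite normrM normfV (ger0_norm (ler0n _ _)) -mulrA -invfM.
have m0 := ler0n R m.
rewrite ler_pdivrMr ?mulr_gt0// -(natr1 m.+1) -(natr1 m).
rewrite [leRHS]mulrC ler_pdivlMr; last lra.
case: m m0 {ih} => [|m] _; first by rewrite subr0 ger0_norm; lra.
have m1 : 1 <= m.+1%:R :> R by rewrite ler1n.
by move: (m.+1%:R) m1 => z z1; rewrite ler0_norm; [nra|lra].
Qed.

Lemma is_derive_exprn N (x : R) :
  is_derive x 1 (fun q : R => q ^+ N) (N%:R * x ^+ N.-1).
Proof.
have := is_deriveX N (is_derive_id x 1).
by rewrite exprfctE /GRing.scale/= mulr1.
Qed.

Let P N q := \sum_(0 <= m < N) b m * q ^+ m.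

(** With (1 + q)^(-3/2) factored out, [gen_binomS] makes the contributions of successive terms
    telescope. For [N = 0] the exponent [N.-1] is harmless, being multiplied by 0. *)
Let is_derive_ratio N q : 0 <= q -> is_derive q 1
  (fun q => P N q * (1 + q) `^ (- (1 / 2)))
  (- (N%:R * b N * q ^+ N.-1 * (1 + q) `^ (- (1 / 2) - 1))).
Proof.
move=> q0; have q10 : 0 < 1 + q by rewrite (lt_le_trans ltr01)// lerDl.
elim: N => [|N ih].
  rewrite !mul0r oppr0 /P.
  under eq_fun do rewrite big_geq// mul0r.
  exact: is_derive_cst.
have dN := is_derive_exprn N q.
have := is_deriveD ih
  (is_deriveM (is_deriveZ (b N) dN) (is_derive_powR1D (- (1 / 2)) q10)).
rewrite (_ : _ + _ = (fun q => P N.+1 q * (1 + q) `^ (- (1 / 2)))); last first.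
  by apply/funext => t; rewrite /P big_nat_recr//= mulrDl.
move=> h; apply: (is_derive_eq h); rewrite /GRing.scale/= gen_binomS.
rewrite -(mul_powRB1 (- (1 / 2)) q10).
by case: N {ih dN h} => [|N]; rewrite /GRing.scale/= ?expr0 ?[q ^+ N.+1]exprS; ring.
Qed.

Lemma sqrt_binomial_approx N q : (0 < N)%N -> 0 <= q <= 1 ->
  `|\sum_(0 <= m < N) b m * q ^+ m - Num.sqrt (1 + q)| <= 2 * N.+1%:R^-1.
Proof.
move=> N0 /andP[q0 q1]; pose r q := P N q * (1 + q) `^ (- (1 / 2)).
have r0 : r 0 = 1.
  rewrite /r addr0 powR1 mulr1 /P big_ltn// big_nat_cond big1.
    by rewrite expr0 mulr1 addr0 /gen_binom big_geq// fact0 divr1.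
  by move=> i /andP[/andP[i0 _] _]; rewrite expr0n gtn_eqF//= mulr0.
(* For either sign [e], adding [|b N| * t ^+ N] to [e * r t] compensates the single term of the
   derivative and gives a nondecreasing function; the two signs together bound [|r q - 1|]. *)
have mono (e : R) : `|e| = 1 -> 0 <= `|b N| * q ^+ N + e * (r q - 1).
  move=> e1; pose G (t : R) := `|b N| * t ^+ N + e * r t.
  have dG (t : R) : 0 <= t -> is_derive t 1 G (N%:R * t ^+ N.-1 *
      (`|b N| - e * b N * (1 + t) `^ (- (1 / 2) - 1))).
    move=> t0; have := is_deriveD (is_deriveZ `|b N| (is_derive_exprn N t))
      (is_deriveZ e (is_derive_ratio N t0)).
    by move=> h; apply: (is_derive_eq h); rewrite /GRing.scale/=; ring.
  have : G 0 <= G q.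
    apply: (@ger0_derive1_ndecr R G 0 1) => //.
    - move=> t; rewrite in_itv/= => /andP[t0 _].
      exact: (@ex_derive _ _ _ _ _ _ _ (dG t (ltW t0))).
    - move=> t; rewrite in_itv/= => /andP[t0 _].
      rewrite derive1E (@derive_val _ _ _ _ _ _ _ (dG t (ltW t0))).
      rewrite mulr_ge0 ?mulr_ge0 ?exprn_ge0 ?(ltW t0)// subr_ge0.
      apply: le_trans (ler_norm _) _; rewrite normrM (normrM e) e1 (mul1r `|b N|).
      rewrite ler_piMr//.
      rewrite ger0_norm ?powR_ge0// -[leRHS](powRr0 (1 + t)).
      by apply: ler_powR; lra.
    - apply: derivable_within_continuous => t; rewrite in_itv/= => /andP[t0 _].
      exact: (@ex_derive _ _ _ _ _ _ _ (dG t t0)).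
  rewrite /G expr0n gtn_eqF//= mulr0 add0r r0; lra.
have h1 := mono 1 (normr1 _); have := mono (-1); rewrite normrN1 => /(_ erefl) h2.
have q10 : 0 < 1 + q by lra.
have -> : \sum_(0 <= m < N) b m * q ^+ m = Num.sqrt (1 + q) * r q.
  rewrite /r mulrCA -powR12_sqrt ?(ltW q10)// -powRD_gt0//.
  by rewrite (_ : 2^-1 - 1 / 2 = 0) ?powRr0 ?mulr1//; lra.
(* The error is [Num.sqrt (1 + q) * (r q - 1)]; the constant 2 is a crude bound for the root. *)
rewrite -[X in _ - X]mulr1 -mulrBr normrM; apply: ler_pM => //.
  rewrite ger0_norm ?sqrtr_ge0// -(ler_pXn2r (n := 2)) ?nnegrE ?sqrtr_ge0//.
  by rewrite sqr_sqrtr ?(ltW q10)//; lra.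
apply: le_trans (gen_binom_half_le N).
apply: (@le_trans _ _ (`|b N| * q ^+ N)).
  by rewrite ler_norml; lra.
by rewrite ler_piMr// exprn_ile1.
Qed.

End BinomialSeries.

(** * The hypergeometric series as an integral *)

Section Series.
Context {R : realType}.
Notation mu := (@lebesgue_measure R).
Implicit Types (n u v x : R) (m N : nat).

Lemma u_coef0 n : u_coef n 0 = if n <= 1 then 1 else n^-1.
Proof. by rewrite /u_coef mulr0 !mul0r !addr0 mul1r. Qed.

Lemma u_coef0_gt0 n : 0 < n -> 0 < u_coef n 0.
Proof. by move=> n0; rewrite u_coef0; case: ifP => _; rewrite ?invr_gt0. Qed.

(** Merges both cases into one arithmetic progression, so that the series is summed without a split
    at [n = 1]. *)
Lemma u_coefE n m : 0 < n ->
  u_coef n m = u_coef n 0 + `|1 - n| / n * 2 * m%:R.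
Proof.
move=> n0; rewrite u_coef0 /u_coef; case: leP => n1.
  by rewrite ger0_norm ?subr_ge0//; field; rewrite gt_eqF.
by rewrite ler0_norm ?subr_le0 ?(ltW n1)//; field; rewrite gt_eqF.
Qed.

Lemma u_coef_gt0 n m : 0 < n -> 0 < u_coef n m.
Proof.
move=> n0; rewrite u_coefE// ltr_pwDl ?u_coef0_gt0//.
by rewrite !mulr_ge0 ?invr_ge0 ?normr_ge0 ?(ltW n0).
Qed.

(** With [w = u + 1] the factor [1 - x] has exponent 0, and the Gamma quotient is [u] by the
    functional equation. *)
Lemma hyp2F1_uD1 v u : 0 < u ->
  hyp2F1 v u (u + 1) (- 1) =
  u * \int[mu]_(x in `]0, 1[) (x `^ (u - 1) * (1 + x) `^ (- v)).
Proof.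
move=> u0.
have e : u + 1 - u = 1 by rewrite addrAC subrr add0r.
have coefE : Gamma (u + 1) / (Gamma u * Gamma (u + 1 - u)) = u.
  rewrite e (GammaD1 u0) Gamma1; move: (Gamma u) (Gamma_gt0 u0) => G G0.
  by rewrite mulr1 mulfK ?gt_eqF.
rewrite /hyp2F1 coefE; congr (u * _).
apply: eq_Rintegral => x _.
by rewrite e subrr powRr0 mulr1 mulN1r opprK.
Qed.

Lemma integrable_itv_cc (f : R -> R) a b : measurable_fun [set: R] f ->
  mu.-integrable `]a, b[ (EFin \o f) -> mu.-integrable `[a, b] (EFin \o f).
Proof.
move=> mf /integrableP[_ foo]; apply/integrableP; split.
  by apply/measurable_EFinP; exact: measurable_funTS.
rewrite integral_itv_bndoo//; apply: measurableT_comp => //.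
by apply/measurable_EFinP; exact: measurable_funTS.
Qed.

(* For x = tan^n theta, the octant of the supercircle has speed
   (a/n) * speed_weight n x * sqrt (1 + sqr_slope n x), where sqr_slope is the
   square of the slope or of its inverse, whichever is at most 1. *)
Definition speed_weight n x : R := x `^ (u_coef n 0 - 1) * (1 + x) `^ (- (1 + 1 / n)).

Definition sqr_slope n x : R := x `^ (`|1 - n| / n * 2).

Lemma speed_weight_ge0 n x : 0 <= speed_weight n x.
Proof. by rewrite mulr_ge0 ?powR_ge0. Qed.

Lemma measurable_speed_weight n (D : set R) : measurable_fun D (speed_weight n).
Proof.
apply: measurable_funM; last exact: measurable_powR1D.
by apply: measurable_funTS; exact: measurable_powR.
Qed.

Lemma integrable_speed_weight n : 0 < n ->
  mu.-integrable `]0, 1[ (EFin \o speed_weight n).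
Proof.
move=> n0; have := integrable_powRB1 (u_coef0_gt0 n0); apply: le_integrable => //.
  by apply/measurable_EFinP; exact: measurable_speed_weight.
move=> x; rewrite /= in_itv/= => /andP[x0 x1].
rewrite lee_fin !ger0_norm ?speed_weight_ge0 ?powR_ge0// ler_piMr ?powR_ge0//.
rewrite -[leRHS](powRr0 (1 + x)); apply: ler_powR; first lra.
by rewrite oppr_le0 addr_ge0// divr_ge0// ltW.
Qed.

Lemma sqr_slope_itv n x : 0 < n -> 0 <= x <= 1 -> 0 <= sqr_slope n x <= 1.
Proof.
move=> n0 /andP[x0 x1]; rewrite powR_ge0/=.
have p0 : 0 <= `|1 - n| / n * 2 by rewrite !mulr_ge0 ?invr_ge0 ?normr_ge0 ?(ltW n0).
rewrite -[leRHS](_ : 1 `^ (`|1 - n| / n * 2) = 1); last by rewrite powR1.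
by apply: ge0_ler_powR; rewrite ?nnegrE.
Qed.

Lemma measurable_sqr_slope n (D : set R) : measurable_fun D (sqr_slope n).
Proof. by apply: measurable_funTS; exact: measurable_powR. Qed.

Lemma integrable_speed_weightM n (g : R -> R) M : 0 < n ->
  measurable_fun [set: R] g -> {in `]0, 1[, forall x, `|g x| <= M} ->
  mu.-integrable `]0, 1[ (EFin \o (fun x => speed_weight n x * g x)).
Proof.
move=> n0 mg gM.
have := @integrableZl _ _ R mu _ (measurable_itv _) M _ (integrable_speed_weight n0).
apply: le_integrable => //.
  apply/measurable_EFinP; apply: measurable_funM; first exact: measurable_speed_weight.
  exact: measurable_funTS.
move=> x x01; rewrite lee_fin !normrM mulrC ler_wpM2r//.
by rewrite (le_trans (gM x x01))// ler_norm.
Qed.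

Lemma integrable_sqr_slopeX n m : 0 < n ->
  mu.-integrable `]0, 1[ (EFin \o (fun x =>
    speed_weight n x * (sqr_slope n x ^+ m))).
Proof.
move=> n0; apply: (@integrable_speed_weightM _ _ 1) => //.
  by apply: measurable_funX; exact: measurable_sqr_slope.
move=> x; rewrite in_itv/= => /andP[x0 x1].
have /andP[q0 q1] : 0 <= sqr_slope n x <= 1 by rewrite sqr_slope_itv// !ltW.
by rewrite ger0_norm ?exprn_ge0// exprn_ile1.
Qed.

Lemma integrable_partial_sum n N : 0 < n ->
  mu.-integrable `]0, 1[ (EFin \o (fun x => speed_weight n x *
    \sum_(0 <= m < N) gen_binom (1 / 2) m * sqr_slope n x ^+ m)).
Proof.
move=> n0; elim: N => [|k ih].
  apply: (@integrable_speed_weightM _ _ 0) => //.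
      by under eq_fun do rewrite big_geq//; exact: measurable_cst.
    by move=> x _; rewrite big_geq// normr0.
have := @integrableD _ _ R mu _ (measurable_itv _) _ _ ih
    (@integrableZl _ _ R mu _ (measurable_itv _) (gen_binom (1 / 2) k) _
      (integrable_sqr_slopeX k n0)).
apply: eq_integrable => // x _ /=.
by rewrite big_nat_recr//= -EFinD; congr EFin; ring.
Qed.

(** The factor [u_coef n m] from [hyp2F1_uD1] cancels its inverse, and the progression [u_coefE]
    turns the power of [x] in Euler's integral into the weight times [sqr_slope n x ^+ m]. The rest
    is finite linearity. *)
Lemma series_hyp2F1E n N : 0 < n ->
  series (fun m => (u_coef n m)^-1 * gen_binom (1 / 2) m *
    hyp2F1 (1 + 1 / n) (u_coef n m) (u_coef n m + 1) (- 1)) N =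
  \int[mu]_(x in `]0, 1[) (speed_weight n x *
    \sum_(0 <= m < N) gen_binom (1 / 2) m * sqr_slope n x ^+ m).
Proof.
move=> n0.
have iQ m := integrable_sqr_slopeX m n0.
have termE m : (u_coef n m)^-1 * gen_binom (1 / 2) m *
    hyp2F1 (1 + 1 / n) (u_coef n m) (u_coef n m + 1) (- 1) =
  gen_binom (1 / 2) m * \int[mu]_(x in `]0, 1[) (speed_weight n x * sqr_slope n x ^+ m).
  have u0 := u_coef_gt0 m n0.
  rewrite hyp2F1_uD1//; move: (gen_binom _ _) => c.
  rewrite mulrACA mulVf ?gt_eqF// [LHS]mul1r; congr (_ * _).
  apply: eq_Rintegral => x; rewrite inE/= in_itv/= => /andP[x0 x1].
  rewrite /speed_weight mulrAC; congr (_ * _).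
  rewrite /sqr_slope -powR_mulrn ?powR_ge0// -powRrM -powRD_gt0//.
  by rewrite (u_coefE m)//; congr (_ `^ _); ring.
have intP k := integrable_partial_sum k n0.
rewrite seriesEnat/=; elim: N => [|N ih].
  rewrite big_geq//; under eq_Rintegral do rewrite big_geq// mulr0.
  by rewrite Rintegral_cst// mul0r.
rewrite big_nat_recr//= ih termE -RintegralZl//.
rewrite -RintegralD//; last first.
  exact: (@integrableZl _ _ R mu _ (measurable_itv _) _ _ (iQ N)).
by apply: eq_Rintegral => x _; rewrite big_nat_recr//=; ring.
Qed.

Lemma measurable_sqrt1D_sqr_slope n :
  measurable_fun [set: R] (fun x => Num.sqrt (1 + sqr_slope n x)).
Proof.
rewrite (_ : (fun x => _) = (fun x => (1 + sqr_slope n x) `^ (1 / 2))); last first.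
  by apply/funext => x; rewrite mul1r powR12_sqrt// addr_ge0// powR_ge0.
apply: (measurableT_comp (measurable_powR _)).
by apply: measurable_funD; [exact: measurable_cst|exact: measurable_sqr_slope].
Qed.

Lemma sqrt1D_le2 (q : R) : 0 <= q <= 1 -> `|Num.sqrt (1 + q)| <= 2.
Proof.
move=> /andP[q0 q1]; rewrite ger0_norm ?sqrtr_ge0//.
rewrite -(ler_pXn2r (n := 2)) ?nnegrE ?sqrtr_ge0//.
by rewrite sqr_sqrtr; lra.
Qed.

Lemma integrable_speed n : 0 < n ->
  mu.-integrable `]0, 1[ (EFin \o (fun x =>
    speed_weight n x * Num.sqrt (1 + sqr_slope n x))).
Proof.
move=> n0; apply: (@integrable_speed_weightM _ _ 2) => //.
  exact: measurable_sqrt1D_sqr_slope.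
move=> x; rewrite in_itv/= => /andP[x0 x1].
by apply: sqrt1D_le2; rewrite sqr_slope_itv// !ltW.
Qed.

(** The uniform error [2 * N.+1%:R^-1] of the binomial sums is integrated against the weight, whose
    total mass [M] is finite. *)
Lemma cvg_series_hyp2F1 n : 0 < n ->
  series (fun m => (u_coef n m)^-1 * gen_binom (1 / 2) m *
    hyp2F1 (1 + 1 / n) (u_coef n m) (u_coef n m + 1) (- 1)) @ \oo -->
  \int[mu]_(x in `]0, 1[) (speed_weight n x * Num.sqrt (1 + sqr_slope n x)).
Proof.
move=> n0; set I := Rintegral _ _ _; set M := \int[mu]_(x in `]0, 1[) speed_weight n x.
have isp := integrable_speed n0; have iw := integrable_speed_weight n0.
have P_bound N x : (0 < N)%N -> x \in `]0, 1[ ->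
    `|\sum_(0 <= m < N) gen_binom (1 / 2) m * sqr_slope n x ^+ m -
      Num.sqrt (1 + sqr_slope n x)| <= 2 * N.+1%:R^-1.
  move=> N0; rewrite in_itv/= => /andP[x0 x1].
  by apply: sqrt_binomial_approx => //; rewrite sqr_slope_itv// !ltW.
have bound N : (0 < N)%N -> `|series (fun m => (u_coef n m)^-1 *
      gen_binom (1 / 2) m *
      hyp2F1 (1 + 1 / n) (u_coef n m) (u_coef n m + 1) (- 1)) N - I| <=
    2 * N.+1%:R^-1 * M.
  move=> N0; rewrite series_hyp2F1E//.
  have iP := integrable_partial_sum N n0.
  rewrite -RintegralB//; apply: le_trans (le_normr_Rintegral _ _) _ => //.
    by have := @integrableB _ _ R mu _ (measurable_itv _) _ _ iP isp.
  rewrite /M -RintegralZl//; apply: le_Rintegral => //.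
  - have := @integrable_norm _ _ R mu _ _
      (@integrableB _ _ R mu _ (measurable_itv _) _ _ iP isp).
    exact.
  - exact: (@integrableZl _ _ R mu _ (measurable_itv _) _ _ iw).
  - move=> x x01; rewrite -mulrBr normrM (ger0_norm (speed_weight_ge0 n x)) [leLHS]mulrC.
    by rewrite ler_wpM2r ?speed_weight_ge0// P_bound.
apply/cvgrPdist_le => /= e e0.
have : 2 * harmonic N * M @[N --> \oo] --> (0 : R).
  rewrite -[X in _ --> X](mul0r M) -[X in _ --> X * M](mulr0 2).
  by apply: cvgM; [apply: cvgM; [exact: cvg_cst|exact: cvg_harmonic]|exact: cvg_cst].
move=> /cvgr0Pnorm_le/(_ e e0) he; near=> N.
rewrite distrC (le_trans (bound N _))//; first by near: N; exact: nbhs_infty_gt.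
by rewrite (le_trans (ler_norm _))//; near: N.
Unshelve. all: by end_near. Qed.

End Series.

(** * The supercircle *)

Section Octant.
Context {R : realType}.
Notation mu := (@lebesgue_measure R).
Implicit Types (a n t : R).

Lemma within_continuous_powRl (D : set R) (f : R -> R) p : 0 <= p ->
  {within D, continuous f} -> (forall x, D x -> 0 <= f x) ->
  {within D, continuous (fun x => f x `^ p)}.
Proof.
move=> + cf f0; rewrite le_eqVlt => /predU1P[<-|p0].
  by under eq_fun do rewrite powRr0; exact: within_continuous_cst.
apply/subspace_continuousP => x Dx; have cfx := within_continuous_cvg cf Dx.
have := f0 x Dx; rewrite le_eqVlt => /predU1P[fx0|fx0]; last first.
  exact: (continuous_cvg _ (@continuous_powR R (f x) p fx0) cfx).
rewrite -fx0 in cfx.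
suff h : (fun y => f y `^ p) @ within D (nbhs x) --> f x `^ p by exact: h.
rewrite -fx0 powR0 ?gt_eqF//; apply/cvgr0Pnorm_lt => e e0.
have d0 : 0 < e `^ p^-1 by rewrite powR_gt0.
have : \forall y \near within D (nbhs x), `|f y| < e `^ p^-1.
  exact: (cvgr0Pnorm_lt _).1 cfx _ d0.
suff : \forall y \near within D (nbhs x), `|f y| < e `^ p^-1 -> `|f y `^ p| < e.
  by move=> h1 h2; apply: filterS2 h1 h2 => y; apply.
rewrite near_withinE; near=> y => Dy; have fy0 := f0 y Dy.
rewrite !ger0_norm ?powR_ge0// => fye.
have := gt0_ltr_powR p0; rewrite /prop_in2 => /(_ (f y) (e `^ p^-1)).
rewrite !nnegrE fy0 powR_ge0 => /(_ isT isT fye).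
by rewrite -powRrM mulVf ?gt_eqF// powRr1// ltW.
Unshelve. all: by end_near. Qed.

Definition octant_x a n t : R := a * (1 + t) `^ (- n^-1).
Definition octant_y a n t : R := a * (t `^ n^-1 * (1 + t) `^ (- n^-1)).

Lemma has_length_octant a n : 0 < a -> 0 < n ->
  has_length (fun t => (octant_x a n t, octant_y a n t)) 0 1
    (a / n * \int[mu]_(t in `]0, 1[)
      (speed_weight n t * Num.sqrt (1 + sqr_slope n t))).
Proof.
move=> a0 n0.
pose s := u_coef n 0.
have n1s : 0 <= n^-1 - s.
  rewrite /s u_coef0; case: (leP n 1) => n1; last by rewrite subrr.
  by rewrite subr_ge0 -invr1 lef_pV2 ?posrE.
have s1 : 0 <= 1 - s.
  rewrite /s u_coef0; case: (leP n 1) => n1; first by rewrite subrr.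
  by rewrite subr_ge0 -invr1 lef_pV2 ?posrE// ltW.
pose D t : R := Num.sqrt (1 + sqr_slope n t).
pose sg t := a / n * (speed_weight n t * D t).
have D0 t : 0 < D t by rewrite sqrtr_gt0 ltr_pwDl// powR_ge0.
(* The velocity is proportional to [(-1, t]^ (n^-1 - 1))[. Taking out]t [^ (s - 1)] leaves exponents
   that are nonnegative, one of them 0, hence a tangent continuous at 0; [D] normalizes it. *)
pose al t := - (t `^ (1 - s) / D t); pose be t := t `^ (n^-1 - s) / D t.
have cst_pow : {within `[0, 1], continuous (fun t : R => t)}.
  by apply: continuous_subspaceT => t; exact: cvg_id.
have in0 t : `[0, 1]%classic t -> 0 <= t by rewrite /= in_itv/= => /andP[].
have cpow p : 0 <= p -> {within `[0, 1], continuous (fun t : R => t `^ p)}.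
  by move=> p0; exact: within_continuous_powRl.
have cpow1 p : {within `[0, 1], continuous (fun t : R => (1 + t) `^ p)}.
  apply: derivable_within_continuous => t; rewrite in_itv/= => /andP[t0 _].
  apply: (@ex_derive _ _ _ _ _ _ _ (is_derive_powR1D p _)); lra.
have D2 t : D t ^+ 2 = 1 + sqr_slope n t.
  by rewrite sqr_sqrtr// addr_ge0// powR_ge0.
have slopeE t : (t `^ (1 - s)) ^+ 2 + (t `^ (n^-1 - s)) ^+ 2 = D t ^+ 2.
  rewrite D2 /sqr_slope /s u_coef0; case: (leP n 1) => n1.
    rewrite subrr powRr0 expr1n; congr (_ + _).
    rewrite -powR_mulrn ?powR_ge0// -powRrM ger0_norm ?subr_ge0//.
    by congr (_ `^ _); field; rewrite gt_eqF.
  rewrite subrr powRr0 expr1n addrC; congr (_ + _).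
  rewrite -powR_mulrn ?powR_ge0// -powRrM ler0_norm ?subr_le0 ?(ltW n1)//.
  by congr (_ `^ _); field; rewrite gt_eqF.
have cDinv : {within `[0, 1], continuous (fun t => (D t)^-1)}.
  have cS : {within `[0, 1], continuous (fun t => 1 + sqr_slope n t)}.
    apply: within_continuous_add; first exact: within_continuous_cst.
    by apply: cpow; rewrite !mulr_ge0 ?invr_ge0 ?normr_ge0 ?(ltW n0).
  apply/subspace_continuousP => t t01; apply: cvgV; first by rewrite gt_eqF.
  apply: continuous_cvg; first exact: sqrt_continuous.
  exact: within_continuous_cvg cS t01.
have -> : a / n * \int[mu]_(t in `]0, 1[)
      (speed_weight n t * Num.sqrt (1 + sqr_slope n t)) =
    \int[mu]_(t in `[0, 1]) sg t.
  rewrite -RintegralZl//; last exact: integrable_speed.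
  congr fine; apply/esym/integral_itv_bndoo.
  apply/measurable_EFinP; apply: measurable_funM; first exact: measurable_cst.
  apply: measurable_funM; first exact: measurable_speed_weight.
  by apply: measurable_funTS; exact: measurable_sqrt1D_sqr_slope.
have interior t : t \in `]0, 1[ -> 0 < t /\ 0 < 1 + t.
  by rewrite in_itv/= => /andP[t0 _]; split => //; rewrite addr_gt0.
apply: (@has_length_unit_tangent R _ _ sg al be) => //.
- apply: integrable_itv_cc.
    apply: measurable_funM; first exact: measurable_cst.
    apply: measurable_funM; first exact: measurable_speed_weight.
    exact: measurable_sqrt1D_sqr_slope.
  exact: (@integrableZl _ _ R mu _ (measurable_itv _) _ _ (integrable_speed n0)).
- move=> t /interior[t0 t10].
  apply: cvgM; first exact: cvg_cst.
  apply: cvgM; first by apply: cvgM; [exact: continuous_powR|exact: continuous_powR1D].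
  apply: continuous_comp; last exact: sqrt_continuous.
  by apply: cvgD; [exact: cvg_cst|exact: continuous_powR].
- move=> t _; apply: mulr_ge0; first by rewrite divr_ge0 ?ltW.
  by rewrite mulr_ge0 ?speed_weight_ge0 ?(ltW (D0 t)).
- move=> t _; rewrite /al /be sqrrN !exprMn -mulrDl slopeE exprVn divff//.
  by rewrite expf_eq0/= gt_eqF.
- by apply: within_continuous_mul => //; exact: within_continuous_cst.
- apply: within_continuous_mul; first exact: within_continuous_cst.
  by apply: within_continuous_mul => //; apply: cpow; rewrite invr_ge0 ltW.
- rewrite (_ : al = (fun t => -1 * (t `^ (1 - s) * (D t)^-1))); last first.
    by apply/funext => t; rewrite mulN1r.
  apply: within_continuous_mul; first exact: within_continuous_cst.
  by apply: within_continuous_mul => //; exact: cpow.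
- by apply: within_continuous_mul => //; exact: cpow.
- move=> t /interior[t0 t10].
  have := is_deriveZ a (is_derive_powR1D (- n^-1) t10).
  move=> h; apply: (is_derive_eq h).
  rewrite /GRing.scale/= /sg /al /speed_weight -/s.
  have -> : - (1 + 1 / n) = - n^-1 - 1 by rewrite mul1r opprD addrC.
  have hs : t `^ (s - 1) * t `^ (1 - s) = 1.
    by rewrite -powRD_gt0// addrA subrK subrr powRr0.
  move: hs (D0 t); move: (t `^ (s - 1)) (t `^ (1 - s)).
  move: ((1 + t) `^ (- n^-1 - 1)) (D t) => z d x y xy d0.
  rewrite -[LHS]mulr1 -xy; field.
  by rewrite !gt_eqF.
- move=> t /interior[t0 t10].
  have d1 : is_derive t 1 (@powR R ^~ n^-1) (n^-1 * t `^ (n^-1 - 1)).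
    exact: is_derive1_powR.
  have := is_deriveZ a (is_deriveM d1 (is_derive_powR1D (- n^-1) t10)).
  move=> h; apply: (is_derive_eq h).
  rewrite /GRing.scale/= /sg /be /speed_weight -/s.
  have -> : - (1 + 1 / n) = - n^-1 - 1 by rewrite mul1r opprD addrC.
  (* With the lower powers factored out, the two terms of the product rule combine through
     [(1 + t) - t = 1]. *)
  rewrite -(mul_powRB1 (- n^-1) t10) -(mul_powRB1 n^-1 t0).
  have -> : n^-1 - 1 = (s - 1) + (n^-1 - s) by ring.
  rewrite powRD_gt0//; field.
  by rewrite !gt_eqF.
Qed.

(** Taking [cos t]^ n[out of the sum leaves]1 + tan t [^ n], and the resulting factor [(cos t)^-1]
    of the radius cancels against the cosine or forms the tangent. *)
Lemma supercircle_octant a n t : 0 < n -> 0 <= t <= pi / 4 ->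
  supercircle a n t = (octant_x a n (tan t `^ n), octant_y a n (tan t `^ n)).
Proof.
move=> n0 /andP[t0 t4].
have pi0 := @pi_gt0 R.
have c0 : 0 < cos t by apply: cos_gt0_pihalf; apply/andP; split; lra.
have s0 : 0 <= sin t by apply: sin_ge0_pi; apply/andP; split; lra.
have tan0 : 0 <= tan t by rewrite divr_ge0// ltW.
have n'0 : n * n^-1 = 1 by rewrite divff// gt_eqF.
have tE : (tan t `^ n) `^ n^-1 = tan t by rewrite -powRrM n'0 powRr1.
have rE : supercircle_radius a n t = a * ((cos t)^-1 * (1 + tan t `^ n) `^ (- n^-1)).
  rewrite /supercircle_radius (gtr0_norm c0) (ger0_norm s0); congr (_ * _).
  have -> : cos t `^ n + sin t `^ n = cos t `^ n * (1 + tan t `^ n).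
    rewrite mulrDr mulr1 -powRM ?(ltW c0)//; congr (_ + _ `^ _).
    by rewrite /tan mulrC divfK// gt_eqF.
  rewrite powRM ?powR_ge0 ?addr_ge0 ?powR_ge0//; congr (_ * _).
  by rewrite -powRrM mulrN n'0 powR_inv1// ltW.
rewrite /supercircle /octant_x /octant_y rE tE; congr (_, _).
  by field; rewrite gt_eqF.
by rewrite /tan; field; rewrite gt_eqF.
Qed.

Lemma has_length_supercircle_octant a n : 0 < a -> 0 < n ->
  has_length (supercircle a n) 0 (pi / 4)
    (a / n * \int[mu]_(t in `]0, 1[)
      (speed_weight n t * Num.sqrt (1 + sqr_slope n t))).
Proof.
move=> a0 n0; have pi0 := @pi_gt0 R.
have sub t : t \in `[0, pi / 4] -> t \in `](- (pi / 2)), (pi / 2)[.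
  by rewrite !in_itv/= => /andP[t0 t1]; apply/andP; split; lra.
have tan_ge0 t : t \in `[0, pi / 4] -> 0 <= tan t.
  rewrite in_itv/= => /andP[t0 t1]; rewrite divr_ge0//.
    by apply: sin_ge0_pi; apply/andP; split; lra.
  by apply: cos_ge0_pihalf; apply/andP; split; lra.
apply: (has_length_comp (phi := fun t => tan t `^ n)) (has_length_octant a0 n0).
- apply: within_continuous_powRl; first exact: ltW.
    apply: derivable_within_continuous => t /sub; rewrite in_itv/= => tI.
    by apply: derivable_tan; rewrite gt_eqF// cos_gt0_pihalf.
  exact: tan_ge0.
- move=> s t sI tI st; apply: ge0_ler_powR; rewrite ?nnegrE ?tan_ge0 ?(ltW n0)//.
  move: st; rewrite le_eqVlt => /predU1P[->//|st].
  by rewrite ltW// ltr_tan ?sub.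
- by rewrite divr_ge0// ltW.
- by rewrite tan0 powR0// gt_eqF.
- by rewrite tan_piquarter powR1.
- move=> s t; rewrite !in_itv/= => sI tI.
  by rewrite !supercircle_octant.
Qed.

Lemma supercircle_reflect a n t :
  supercircle a n (pi / 2 - t) = ((supercircle a n t).2, (supercircle a n t).1).
Proof.
have cE : cos (pi / 2 - t) = sin t by rewrite -cosBpihalf -cosN opprB.
have sE : sin (pi / 2 - t) = cos t.
  by rewrite addrC sinDpihalf cosN.
by rewrite /supercircle /supercircle_radius cE sE [X in X `^ _]addrC.
Qed.

Lemma supercircle_rotate a n t :
  supercircle a n (t + pi / 2) = (- (supercircle a n t).2, (supercircle a n t).1).
Proof.
rewrite /supercircle /supercircle_radius cosDpihalf sinDpihalf normrN.
by rewrite [X in X `^ _]addrC mulrN.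
Qed.

Lemma has_length_rotate a n A L : 0 <= A ->
  has_length (supercircle a n) 0 A L ->
  has_length (supercircle a n) (pi / 2) (A + pi / 2) L.
Proof.
move=> A0; apply: (has_length_comp (phi := fun t => t - pi / 2)).
- by apply: continuous_subspaceT => t; apply: cvgB; [exact: cvg_id|exact: cvg_cst].
- by move=> s t _ _; rewrite lerD2r.
- by rewrite lerDr.
- by rewrite subrr.
- by rewrite addrK.
- move=> s t _ _; rewrite -{1}(subrK (pi / 2) s) -{1}(subrK (pi / 2) t).
  rewrite !supercircle_rotate.
  move: (supercircle a n (s - pi / 2)) (supercircle a n (t - pi / 2)) => p q.
  by rewrite /eucl_dist/= -opprD sqrrN addrC.
Qed.

Lemma has_length_supercircle a n : 0 < a -> 0 < n ->
  has_length (supercircle a n) 0 (2 * pi)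
    (8 * a / n * \int[mu]_(t in `]0, 1[)
      (speed_weight n t * Num.sqrt (1 + sqr_slope n t))).
Proof.
move=> a0 n0; have pi0 := @pi_gt0 R; set I := Rintegral _ _ _.
have o1 := has_length_supercircle_octant a0 n0; rewrite -/I in o1.
(* The second octant mirrors the first in the diagonal, traversed backwards. *)
have o2 : has_length (supercircle a n) (pi / 4) (pi / 2) (a / n * I).
  apply: (@has_length_rev _ (supercircle a n) _ _ _ _ _ (pi / 2)) o1; [lra|lra|].
  move=> s t _ _; rewrite !supercircle_reflect /eucl_dist/=.
  by rewrite addrC.
have q1 : has_length (supercircle a n) 0 (pi / 2) (a / n * I + a / n * I).
  by apply: (has_length_cat _ _ o1 o2); lra.
have pi2 : 0 <= pi / 2 :> R by lra.
(* Puts the first quadrant before the arc over [[0, A]] turned by a right angle; three uses starting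
   from [A = pi / 2] close the curve. *)
have next A L : 0 <= A -> has_length (supercircle a n) 0 A L ->
    has_length (supercircle a n) 0 (A + pi / 2) (a / n * I + a / n * I + L).
  move=> A0 h; apply: (has_length_cat _ _ q1); [lra|lra|].
  exact: has_length_rotate.
have h2 := next _ _ pi2 q1.
have h3 : has_length _ _ _ _ := next _ _ (addr_ge0 pi2 pi2) h2.
have := next _ _ (addr_ge0 (addr_ge0 pi2 pi2) pi2) h3.
congr has_length; last by ring.
by field.
Qed.

End Octant.

(** Convergence is asserted alongside the formula because [limn] of a divergent sequence is only a
    default value. *)
Theorem theorem3p1 (R : realType) (a n : R) (a_gt0 : 0 < a) (n_gt0 : 0 < n) :
  let term (m : nat) : R :=
    (u_coef n m)^-1 * gen_binom (1 / 2) m *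
    hyp2F1 (1 + 1 / n) (u_coef n m) (u_coef n m + 1) (- 1) in
  cvgn (series term) /\
  arc_length 0 (2 * pi) (supercircle a n) =
    (8 * a / n * limn (series term))%:E.
Proof.
move=> term; have h := cvg_series_hyp2F1 n_gt0.
split; first by apply/cvg_ex; eexists; exact: h.
rewrite (cvg_lim _ h)//; apply: has_length_arc_length; last exact: has_length_supercircle.
by rewrite mulr_ge0// ltW// pi_gt0.
Qed.
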